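(* Let $a,b\in\mathbb{C}$ be non-zero and, for each $m\ge 1$, let $\mathcal{T}=\mathcal{T}_m\in\mathbb{C}^{2m\times 2m}$ be the block tridiagonal block Toeplitz matrix with $2\times 2$ blocks having $A_0$ on the block diagonal, $A_1$ on the first block superdiagonal and $A_{-1}$ on the first block subdiagonal (all other blocks zero), where $$A_0=\begin{bmatrix}0&b\\ b&0\end{bmatrix},\qquad A_1=\begin{bmatrix}a&0\\0&0\end{bmatrix},\qquad A_{-1}=\begin{bmatrix}0&0\\0&a\end{bmatrix}.$$ Then the limiting spectrum of $\mathcal{T}_m$ as $m\to\infty$ lies on the curve defined by $$\lambda_{\pm}(\theta)=a\cos(\theta)\pm\sqrt{b^2-a^2\sin^2(\theta)},\qquad \theta\in[-\pi,\pi],$$ except perhaps for the eigenvalues $$\lambda=\pm\sqrt{\tfrac12 b^2-a^2},$$ which can only occur if $|a^2|>\left|\tfrac12 b^2-a^2\right|$.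
   Context: The coefficients $a,b$ are fixed independently of $m$. The limiting spectrum of $(\mathcal{T}_m)_{m\ge1}$ as $m\to\infty$ means the set of all $\lambda\in\mathbb{C}$ that are limits of subsequences of sequences $(z_m)$, where $z_m$ is an eigenvalue of $\mathcal{T}_m$. Since both signs $\pm$ are taken, the choice of branch of the square root is immaterial. *)

(* Defs.v *)
From HB Require Import structures.
From mathcomp Require Import all_boot all_order all_algebra.
From mathcomp Require Import complex.
From mathcomp Require Import all_classical all_reals all_analysis.

Set Implicit Arguments.
Unset Strict Implicit.
Unset Printing Implicit Defensive.

Import Order.TTheory GRing.Theory Num.Theory.
Import numFieldNormedType.Exports.

Local Open Scope classical_set_scope.
Local Open Scope complex_scope.
Local Open Scope ring_scope.

Definition mx22 (K : nzRingType) (w x y z : K) : 'M[K]_2 :=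
  @block_mx K 1 1 1 1 w%:M x%:M y%:M z%:M.

Lemma sum_2_ord (m : nat) : (\sum_(i < m) 2 = 2 * m)%N.
Proof. by rewrite sum_nat_const card_ord mulnC. Qed.

Definition block_tridiag_toeplitz (K : nzRingType) (Am1 A0 A1 : 'M[K]_2)
    (m : nat) : 'M[K]_(2 * m) :=
  castmx (sum_2_ord m, sum_2_ord m)
    (\mxblock_(i < m, j < m)
       (if j == i :> nat then A0
        else if j == i.+1 :> nat then A1
        else if i == j.+1 :> nat then Am1
        else 0)).

Definition T_mx (K : nzRingType) (a b : K) (m : nat) : 'M[K]_(2 * m) :=
  block_tridiag_toeplitz (mx22 0 0 0 a) (mx22 0 b b 0) (mx22 a 0 0 0) m.

(* The value at index 0 of the sequence z is unconstrained: matrices are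
   indexed by m >= 1. *)
Definition limiting_spectrum (K : numFieldType) (d : nat -> nat)
    (T : forall m, 'M[K]_(d m)) : set K :=
  [set l | exists (z : nat -> K) (phi : nat -> nat),
     [/\ forall m, (0 < m)%N -> eigenvalue (T m) (z m),
         {homo phi : p q / (p < q)%N} &
         z (phi n) @[n --> \oo] --> l]].

Definition spectral_curve (R : realType) (a b : R[i]) : set R[i] :=
  [set l | exists2 theta : R, theta \in `[- pi, pi] &
     let r := sqrtC (b ^+ 2 - a ^+ 2 * (sin theta)%:C ^+ 2) in
     l = a * (cos theta)%:C + r \/ l = a * (cos theta)%:C - r].

(* Main.v *)
Require Import Defs.
From HB Require Import structures.
From mathcomp Require Import all_boot all_order all_algebra.
From mathcomp Require Import complex.
From mathcomp Require Import all_classical all_reals all_analysis.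
From mathcomp Require Import ring zify.

Set Implicit Arguments.
Unset Strict Implicit.
Unset Printing Implicit Defensive.

Import Order.TTheory GRing.Theory Num.Theory.
Import numFieldNormedType.Exports.

Local Open Scope classical_set_scope.
Local Open Scope complex_scope.
Local Open Scope ring_scope.

(** Write an eigenvector of the matrix as two sequences u and v.  Since b is
non-zero, v can be eliminated, and u satisfies the three-term recurrence
  a l (u_(i+1) + u_(i-1)) = (l^2 + a^2 - b^2) u_i
with boundary conditions u_0 = 0 and l u_(m+1) = a u_m.  Let p and q be the two
numbers with sum l^2 + a^2 - b^2 and product (a l)^2; the ratios p / (a l) and
q / (a l) are the characteristic roots of the recurrence.  Telescoping along
each root turns the boundary conditions into the single equation
  p^m (p - a^2) = q^m (q - a^2)                   (eigenvalue_T_mx_roots).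

Now (p - a^2) (q - a^2) = (a b)^2 is a non-zero constant, so while l stays
bounded neither factor can be small.  If, say, |q| <= |p|, it follows that
|p|^m is at most a constant times |q|^m, and |p| - |q| is of order 1/m
(norm_gap_of_pow_eq).  To pass to the limit without following the individual
roots, one uses that 2 (|p| - |q|)^2 is the continuous function modulus_gap of l
(modulus_gapE, a parallelogram identity).  It therefore vanishes at each limit l
of eigenvalues, where |p| = |q|.

If |p| = |q| and l <> 0 then p / (a l) is on the unit circle, say equal to
exp(i theta), and the equation for the sum reads
  l^2 + a^2 - b^2 = 2 a l cos(theta),
which is the quadratic equation of the curve (modulus_gap0_spectral_curve).  So
every limit of eigenvalues lies on the curve.  Working with p and q instead of
the characteristic roots keeps l = 0 within the same argument. *)

(** * The eigenvector equations *)

Lemma mx22E (K : nzRingType) (w x y z : K) (i j : 'I_2) :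
  mx22 w x y z i j =
  if i == 0 then (if j == 0 then w else x) else (if j == 0 then y else z).
Proof.
have val2 (k : 'I_2) : (k == 0) = (k < 1)%N by rewrite ltnS leqn0.
rewrite !val2 /mx22 !mxE.
by case: splitP => i' ->; rewrite !mxE; case: splitP => j' ->;
  rewrite !mxE !ord1 eqxx mulr1n.
Qed.

Lemma row_mul_mx22 (K : nzRingType) (r : 'rV[K]_2) (w x y z : K) :
  (r *m mx22 w x y z) 0 0 = r 0 0 * w + r 0 1 * y /\
  (r *m mx22 w x y z) 0 1 = r 0 0 * x + r 0 1 * z.
Proof.
have E1 : lift ord0 ord0 = 1 :> 'I_2 by apply: val_inj.
by split; rewrite mxE !big_ord_recl big_ord0 addr0 !mx22E E1.
Qed.

Lemma row2_eq0 (K : nmodType) (r : 'rV[K]_2) : r 0 0 = 0 -> r 0 1 = 0 -> r = 0.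
Proof.
move=> e0 e1; apply/rowP => i; rewrite mxE.
have [->//|i0] := eqVneq i 0.
have -> // : i = 1 by apply/val_inj; case: i i0 => [[|[|]]].
Qed.

Lemma eigenvalue_castmx (F : fieldType) (n n' : nat) (e : n = n')
    (A : 'M[F]_n) (l : F) :
  eigenvalue (castmx (e, e) A) l = eigenvalue A l.
Proof. by case: n' / e; rewrite castmx_id. Qed.

(** The entry in position 1 of block i of the eigenvector is u_(i+1), the one in
position 2 is v_i.  This shift makes room for the boundary value u_0, and the
values u_0 = 0 and v_m = 0 let the first and the last block obey the same
equations as the inner ones. *)
Lemma eigenvalue_T_mx_rec (F : fieldType) (a b l : F) (m : nat) :
    eigenvalue (T_mx a b m) l ->
  exists u v : nat -> F,
    [/\ u 0 = 0, v m = 0,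
        forall i, (i < m)%N ->
          a * u i + b * v i = l * u i.+1 /\ b * u i.+1 + a * v i.+1 = l * v i &
        exists2 i, (i < m)%N & u i.+1 != 0 \/ v i != 0].
Proof.
rewrite /T_mx /block_tridiag_toeplitz eigenvalue_castmx.
case/eigenvalueP => w; rewrite -[w]submxrowK; set r := submxrow w.
rewrite mul_mxrow_mxblock.
have -> : l *: \mxrow_j r j = \mxrow_j (l *: r j).
  by apply/matrixP => i j; rewrite !mxE.
move=> /eq_mxrowP Hr r0.
(* Blocks with index m or more are zero, which encodes v_m = 0. *)
pose R i : 'rV[F]_2 := if insub i is Some k then r k else 0.
have RE (k : 'I_m) : R k = r k by rewrite /R valK.
have R0 i : (m <= i)%N -> R i = 0.
  by move=> mi; rewrite /R insubF // ltnNge mi.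
exists (fun i => if i is i'.+1 then R i' 0 0 else 0), (fun i => R i 0 1).
split=> //.
- by rewrite R0 // mxE.
- move=> j jm; have := Hr (Ordinal jm).
  have pick k A :
      \sum_(i < m) (if i == k :> nat then R i *m A else 0) = R k *m A.
    case: (ltnP k m) => km; last first.
      rewrite R0 // mul0mx big1 // => i _; case: eqP => // ik.
      by move: (ltn_ord i); rewrite ik ltnNge km.
    rewrite (bigD1 (Ordinal km)) //= eqxx big1 ?addr0 // => i ik.
    by rewrite -[k]/(val (Ordinal km)) (inj_eq val_inj) (negPf ik).
  rewrite -RE /= (eq_bigr (fun i : 'I_m =>
      (if i == j :> nat then R i *m mx22 0 b b 0 else 0) +
      ((if i.+1 == j :> nat then R i *m mx22 a 0 0 0 else 0) +
       (if i == j.+1 :> nat then R i *m mx22 0 0 0 a else 0)))); last first.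
    move=> i _; rewrite RE (eq_sym (j : nat)) (eq_sym (j : nat)).
    case: (ltngtP (i : nat) j) => [ij|ij|ij].
    - have -> : (i == j.+1 :> nat) = false by lia.
      by case: eqP; rewrite ?mulmx0 ?addr0 ?add0r.
    - have -> : (i.+1 == j :> nat) = false by lia.
      by case: eqP; rewrite ?mulmx0 ?addr0 ?add0r.
    - have -> : (i.+1 == j :> nat) = false by lia.
      have -> : (i == j.+1 :> nat) = false by lia.
      by rewrite !addr0.
  have mxD (M N : 'rV[F]_2) k : (M + N) 0 k = M 0 k + N 0 k by rewrite mxE.
  have mxZ c (M : 'rV[F]_2) k : (c *: M) 0 k = c * M 0 k by rewrite mxE.
  rewrite !big_split /= !pick => E.
  have [X1 X2] := row_mul_mx22 (R j) 0 b b 0.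
  have [Y1 Y2] := row_mul_mx22 (R j.+1) 0 0 0 a.
  have /= := congr1 (fun M : 'rV_2 => M 0 1) E.
  have {E} /= := congr1 (fun M : 'rV_2 => M 0 0) E.
  case: j jm X1 X2 Y1 Y2 => [|j] jm X1 X2 Y1 Y2.
    rewrite big1 // !add0r !mxD X1 X2 Y1 Y2 !mxZ.
    by move=> <- <-; split; ring.
  under eq_bigr do rewrite eqSS.
  have [Z1 Z2] := row_mul_mx22 (R j) a 0 0 0.
  rewrite pick !mxD X1 X2 Y1 Y2 Z1 Z2 !mxZ.
  by move=> <- <-; split; ring.
- have /existsP [k rk] : [exists k, r k != 0].
    apply: contraNT r0; rewrite negb_exists => /forallP rz.
    have {}rz k : r k = 0 by apply/eqP; move: (rz k); rewrite negbK.
    by apply/eqP/matrixP => i j; rewrite mxE rz !mxE.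
  exists k => //; rewrite RE.
  have [e0|] := eqVneq (r k 0 0) 0; last by left.
  by right; apply: contraNneq rk => /(row2_eq0 e0) ->.
Qed.

(** * The boundary conditions as an equation between the roots *)

(** Lets ring deduce an equation from another one that differs from it by a
rearrangement of terms. *)
Lemma eq_sub_transfer (V : zmodType) (x y x' y' : V) :
  x = y -> x' - y' = x - y -> x' = y'.
Proof. by move=> -> /eqP; rewrite subrr subr_eq0 => /eqP. Qed.

(** The combination a l u_(i+1) - p u_i is multiplied by q / (a l) when i grows
by one, and symmetrically.  Comparing its first and last values for both roots
and eliminating u_m gives the equation.  If l = 0 the recurrence has a zero
leading coefficient; then an eigenvector exists only if p + q = 0, so that
p = q = 0 and both sides vanish. *)
Lemma eigenvalue_T_mx_roots (F : fieldType) (a b l p q : F) (m : nat) :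
    a != 0 -> b != 0 -> (0 < m)%N -> eigenvalue (T_mx a b m) l ->
    p + q = l ^+ 2 + a ^+ 2 - b ^+ 2 -> p * q = (a * l) ^+ 2 ->
  p ^+ m * (p - a ^+ 2) = q ^+ m * (q - a ^+ 2).
Proof.
move=> a0 b0 m0 /eigenvalue_T_mx_rec [u [v [u0 vm rec [k km nz]]]] pDq pMq.
have urec i : (i < m)%N ->
    b ^+ 2 * u i.+1 + a * (b * v i.+1) = l * (l * u i.+1 - a * u i).
  move=> im; have [E1 E2] := rec i im.
  have -> : l * u i.+1 - a * u i = b * v i by rewrite -E1; ring.
  by rewrite [RHS]mulrCA -E2; ring.
have bv i : (i < m)%N -> b * v i = l * u i.+1 - a * u i.
  by move=> im; have [E _] := rec i im; rewrite -E; ring.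
have ustep i : (i.+1 < m)%N ->
    a * l * u i.+2 = (p + q) * u i.+1 - a * l * u i.
  move=> im; have := urec i (ltnW im); rewrite bv // pDq => /eq_sub_transfer.
  by apply; ring.
have uend : a ^+ 2 * u m = (p + q) * u m - a * l * u m.-1.
  move: (urec m.-1); rewrite prednK // leqnn vm pDq => /(_ isT).
  move=> /eq_sub_transfer.
  by apply; ring.
have ueq0 : (forall i, (i < m)%N -> u i.+1 = 0) -> False.
  move=> uz; case: nz => [|/eqP vk0]; first by rewrite uz ?eqxx.
  apply: vk0; apply: (mulfI b0); rewrite mulr0 bv // uz // mulr0 sub0r.
  by case: k km => [|k] km; rewrite ?u0 ?uz ?mulr0 ?oppr0 // ltnW.
have [l0|l0] := eqVneq l 0.
  have [pDq0|pDq0] := eqVneq (p + q) 0; last first.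
    exfalso; apply: ueq0 => i; rewrite leq_eqVlt => /predU1P[im|im].
      move: uend; rewrite -im pDq l0 => E.
      have : b ^+ 2 * u i.+1 = 0 by apply: (eq_sub_transfer E); ring.
      by move/eqP; rewrite mulf_eq0 expf_eq0 (negPf b0) /= => /eqP.
    apply: (mulfI pDq0); rewrite mulr0.
    by have := ustep i im; rewrite l0 mulr0 !mul0r subr0.
  have [p0|p0] := eqVneq p 0; first by move: pDq0; rewrite p0 add0r => ->.
  move: pMq; rewrite l0 mulr0 expr0n /= => /eqP; rewrite mulf_eq0 (negPf p0) /=.
  by move=> /eqP q0; move: pDq0 p0; rewrite q0 addr0 => ->; rewrite eqxx.
have al0 : a * l != 0 by rewrite mulf_neq0.
have u1 : u 1%N != 0.
  apply/eqP => u1; apply: ueq0.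
  suff H i : (i < m)%N -> u i = 0 /\ u i.+1 = 0 by move=> i /H[].
  elim: i => [//|i IH] im; have [ui uSi] := IH (ltnW im); split=> //.
  by apply: (mulfI al0); rewrite ustep // ui uSi !mulr0 subrr.
(* p' and q' stand for the two roots in either order. *)
have tele p' q' : p' + q' = p + q -> p' * q' = p * q -> forall i, (i < m)%N ->
    (a * l) ^+ i * (a * l * u i.+1 - p' * u i) = q' ^+ i * (a * l * u 1%N).
  move=> pDq' pMq'; elim=> [|i IH] im; first by rewrite u0; ring.
  rewrite ustep // (exprS q') -[RHS]mulrA -IH 1?ltnW // -pDq'.
  rewrite pMq in pMq'; rewrite exprS; ring: pMq'.
(* The last equation of the eigenvector plays the role of l u_(m+1) = a u_m. *)
have last p' q' : p' + q' = p + q -> p' * q' = p * q ->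
    (a * l) ^+ m * (a ^+ 2 - p') * u m = q' ^+ m * (a * l * u 1%N).
  move=> pDq' pMq'; have := tele p' q' pDq' pMq' m.-1.
  rewrite prednK // leqnn => /(_ isT) E.
  have -> : q' ^+ m = q' * q' ^+ m.-1 by rewrite -exprS prednK.
  have -> : (a * l) ^+ m = a * l * (a * l) ^+ m.-1 by rewrite -exprS prednK.
  rewrite -[RHS]mulrA -E.
  rewrite pMq in pMq'; rewrite -pDq' in uend.
  have -> : a * l * (a * l) ^+ m.-1 * (a ^+ 2 - p') * u m =
     a * l * (a * l) ^+ m.-1 * (a ^+ 2 * u m - p' * u m) by ring.
  rewrite uend; ring: pMq'.
have Lp := last p q erefl erefl.
have Lq := last q p (addrC q p) (mulrC q p).
have alu0 : a * l * u 1%N != 0 by rewrite mulf_neq0.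
apply: (mulIf alu0).
transitivity ((a * l) ^+ m * (a ^+ 2 - q) * u m * (p - a ^+ 2)).
  by rewrite Lq; ring.
transitivity ((a * l) ^+ m * (a ^+ 2 - p) * u m * (q - a ^+ 2)); first by ring.
by rewrite Lp; ring.
Qed.

(** * The moduli of the roots approach each other *)

(** Factoring x^m - y^m leaves m terms, each at least y^(m-1). *)
Lemma ler_gap_pow (K : numDomainType) (x y c : K) (m : nat) :
    (0 < m)%N -> 0 <= y -> y <= x -> x ^+ m <= c * y ^+ m ->
  m%:R * (x - y) <= c * y.
Proof.
case: m => // m _ y0 yx xy.
have x0 := le_trans y0 yx.
have [yz|yn0] := eqVneq y 0.
  move: xy; rewrite yz expr0n mulr0 => xm0.
  have : x ^+ m.+1 == 0 by rewrite eq_le xm0 exprn_ge0.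
  by rewrite expf_eq0 /= => /eqP ->; rewrite subrr mulr0.
have ym0 : 0 < y ^+ m by rewrite exprn_gt0 // lt0r yn0.
rewrite -(ler_pM2r ym0) -(mulrA c) -exprS.
apply: le_trans (_ : x ^+ m.+1 - y ^+ m.+1 <= _); last first.
  by apply: le_trans xy; rewrite lerBlDr lerDl exprn_ge0.
have -> : m.+1%:R * (x - y) * y ^+ m = (x - y) * (y ^+ m *+ m.+1).
  by rewrite -[y ^+ m *+ _]mulr_natl; ring.
rewrite subrXX ler_wpM2l ?subr_ge0 //.
rewrite -[m.+1 in leLHS]card_ord -sumr_const ler_sum // => i _ /=.
have im : (i <= m)%N by rewrite -ltnS.
by rewrite -{1}(subnK im) exprD ler_wpM2r ?exprn_ge0 // lerXn2r ?nnegrE.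
Qed.

(** With |q| <= |p|, multiplying the equation by |q - c| gives
|p|^m |(p - c) (q - c)| = |q|^m |q - c|^2, so |p|^m is at most a constant times
|q|^m whenever (p - c) (q - c) is bounded away from zero. *)
Lemma norm_gap_of_pow_eq (K : numFieldType) (p q c M : K) (m : nat) :
    (0 < m)%N -> `|p| <= M -> `|q| <= M ->
    p ^+ m * (p - c) = q ^+ m * (q - c) ->
  m%:R * `| `|p| - `|q| | * `|(p - c) * (q - c)| <= (M + `|c|) ^+ 2 * M.
Proof.
move=> m0.
wlog qp : p q / `|q| <= `|p|.
  move=> H pM qM E.
  have /orP[qp|pq] := real_leVge (normr_real q) (normr_real p).
    exact: H.
  by rewrite distrC (mulrC (p - c)); apply: H.
move=> pM qM E.
have M0 : 0 <= M by apply: le_trans pM.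
have [->|D0] := eqVneq ((p - c) * (q - c)) 0.
  by rewrite normr0 mulr0 mulr_ge0 ?exprn_ge0 ?addr_ge0.
have Dp : 0 < `|(p - c) * (q - c)| by rewrite normr_gt0.
rewrite ger0_norm ?subr_ge0 // -ler_pdivlMr //.
apply: le_trans (_ : (M + `|c|) ^+ 2 / `|(p - c) * (q - c)| * `|q| <= _);
  last first.
  by rewrite mulrAC ler_pM2r ?invr_gt0 // ler_wpM2l // exprn_ge0 // addr_ge0.
apply: ler_gap_pow => //.
rewrite mulrAC ler_pdivlMr // -!normrX -!normrM.
have -> : p ^+ m * ((p - c) * (q - c)) = q ^+ m * (q - c) ^+ 2.
  by rewrite mulrA E; ring.
rewrite normrM [leRHS]mulrC normrX ler_wpM2l // normrX.
rewrite lerXn2r ?nnegrE ?addr_ge0 //.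
by apply: le_trans (ler_normB _ _) _; rewrite lerD2r.
Qed.

Definition root_sum (K : pzRingType) (a b l : K) := l ^+ 2 + a ^+ 2 - b ^+ 2.

(** Twice the square of |p| - |q| for the roots p and q attached to l, written
without the roots so as to be visibly continuous in l. *)
Definition modulus_gap (K : numDomainType) (a b l : K) :=
  `|root_sum a b l| ^+ 2
  + `|root_sum a b l ^+ 2 - 4 * (a * l) ^+ 2| - 4 * `|a * l| ^+ 2.

(** The parallelogram identity for p and q, with (p - q)^2 = (p + q)^2 - 4 p q
and |p q| = |a l|^2. *)
Lemma modulus_gapE (K : numClosedFieldType) (a b l p q : K) :
    p + q = root_sum a b l -> p * q = (a * l) ^+ 2 ->
  modulus_gap a b l = 2 * (`|p| - `|q|) ^+ 2.
Proof.
rewrite /modulus_gap => <- pMq; rewrite -(normrX 2 (a * l)) -pMq.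
have -> : (p + q) ^+ 2 - 4 * (p * q) = (p - q) ^+ 2 by ring.
rewrite normrX normrM sqrrB !normCK rmorphB rmorphD; ring.
Qed.

Lemma ex_sum_prod (K : numClosedFieldType) (s t : K) :
  exists p q : K, p + q = s /\ p * q = t.
Proof.
exists ((s + sqrtC (s ^+ 2 - 4 * t)) / 2), ((s - sqrtC (s ^+ 2 - 4 * t)) / 2).
split; first by field.
transitivity ((s ^+ 2 - sqrtC (s ^+ 2 - 4 * t) ^+ 2) / 4); first by field.
by rewrite sqrtCK; field.
Qed.

Lemma norm_root_le (K : numFieldType) (p q s d : K) :
  p + q = s -> p * q = d ^+ 2 -> `|p| <= `|s| + `|d|.
Proof.
move=> pDq pMq; have sd0 : 0 <= `|s| + `|d| by rewrite addr_ge0.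
have [//|lt] := real_leP (normr_real p) (ger0_real sd0).
have p0 : 0 < `|p| by apply: le_lt_trans lt.
have : `|p| ^+ 2 <= `|s| * `|p| + `|d| ^+ 2.
  rewrite -normrX -normrX -normrM.
  have -> : p ^+ 2 = s * p - d ^+ 2 by rewrite -pDq -pMq; ring.
  exact: ler_normB.
rewrite -lerBlDl expr2 -mulrBl => H.
have dlt : `|d| < `|p| - `|s| by rewrite ltrBrDl.
have : `|d| ^+ 2 < (`|p| - `|s|) * `|p|.
  rewrite expr2; apply: le_lt_trans (_ : `|d| * `|p| < _); last first.
    by rewrite ltr_pM2r.
  by rewrite ler_wpM2l // ltW // (le_lt_trans _ lt) // lerDr.
by move=> /(le_lt_trans H); rewrite ltxx.
Qed.

(** M bounds both roots (norm_root_le).  Only continuity in l matters later, and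
the factor 2 M pays for replacing (|p| - |q|)^2 by | |p| - |q| |. *)
Definition modulus_gap_bound (K : numDomainType) (a b l : K) :=
  let M := `|root_sum a b l| + `|a * l| in
  2 * M * ((M + `|a ^+ 2|) ^+ 2 * M).

(** Here (p - a^2) (q - a^2) = (a b)^2, a constant, so the estimate for the
roots becomes one that is uniform for l in bounded sets. *)
Lemma eigenvalue_modulus_gap_le (K : numClosedFieldType) (a b l : K) (m : nat) :
    a != 0 -> b != 0 -> (0 < m)%N -> eigenvalue (T_mx a b m) l ->
  m%:R * (modulus_gap a b l * `|a * b| ^+ 2) <= modulus_gap_bound a b l.
Proof.
move=> a0 b0 m0 ev.
have [p [q [pDq pMq]]] := ex_sum_prod (root_sum a b l) ((a * l) ^+ 2).
have E := eigenvalue_T_mx_roots a0 b0 m0 ev pDq pMq.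
have pM := norm_root_le pDq pMq.
have qM : `|q| <= `|root_sum a b l| + `|a * l|.
  by apply: (@norm_root_le _ q p); rewrite 1?addrC 1?mulrC.
have {E} := norm_gap_of_pow_eq m0 pM qM E.
have -> : (p - a ^+ 2) * (q - a ^+ 2) = (a * b) ^+ 2.
  transitivity (p * q - a ^+ 2 * (p + q) + a ^+ 4); first by ring.
  by rewrite pDq pMq /root_sum; ring.
rewrite (modulus_gapE pDq pMq) normrX /modulus_gap_bound.
set M := _ + `|a * l| in pM qM *.
set d := `| `|p| - `|q| | => H.
have d0 : 0 <= d by rewrite /d normr_ge0.
have dM : d <= M.
  have /orP[qp|pq] := real_leVge (normr_real q) (normr_real p).
    by rewrite /d ger0_norm ?subr_ge0 // lerBlDr (le_trans pM) ?lerDl.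
  by rewrite /d distrC ger0_norm ?subr_ge0 // lerBlDr (le_trans qM) ?lerDl.
have M0 : 0 <= M by apply: le_trans d0 dM.
have -> : (`|p| - `|q|) ^+ 2 = d ^+ 2.
  by rewrite /d real_normK // rpredB // normr_real.
have -> : m%:R * (2 * d ^+ 2 * `|a * b| ^+ 2) =
          2 * d * (m%:R * d * `|a * b| ^+ 2) by ring.
by rewrite ler_pM ?mulr_ge0 ?exprn_ge0 // ler_wpM2l.
Qed.

(** * Passage to the limit *)

Lemma complex_archi (R : realType) (x : R[i]) : 0 <= x -> exists n, x < n%:R.
Proof.
case: x => x y; rewrite lecE /= => /andP[/eqP -> x0].
exists (Num.bound x); rewrite -(rmorph_nat (@real_complex R)) /= ltcR.
exact: archi_boundP.
Qed.

(** Stated over an abstract field because the topology on complex numbers comes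
from their structure of numeric field; the Archimedean property is then a
hypothesis. *)
Lemma cvg_eq0_of_natM_bounded (K : numFieldType) (h c : nat -> K) (h0 c0 : K) :
    (forall x : K, 0 <= x -> exists n, x < n%:R) ->
    h n @[n --> \oo] --> h0 -> c n @[n --> \oo] --> c0 ->
    (forall n, 0 <= h n) -> (forall n, (0 < n)%N -> n%:R * h n <= c n) ->
  h0 = 0.
Proof.
move=> archi hh cc hge le; apply/eqP; apply: contraT => h0n.
have e0 : 0 < `|h0| / 2 by rewrite divr_gt0 ?normr_gt0.
have B0 : 0 <= (`|c0| + 1) / (`|h0| / 2) by rewrite divr_ge0 ?addr_ge0 // ltW.
have [N HN] := archi _ B0.
have : \forall n \near \oo, False.
  near=> n.
  have n0 : (0 < n)%N by near: n; exists 1%N.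
  have Nn : (N <= n)%N by near: n; exists N.
  have hn : `|h0 - h n| < `|h0| / 2 by near: n; apply: cvgr_dist_lt.
  have cn : `|c0 - c n| < 1 by near: n; apply: cvgr_dist_lt.
  have hn' : `|h0| / 2 <= h n.
    rewrite -(ger0_norm (hge n)).
    have := ler_normD (h0 - h n) (h n); rewrite subrK => H.
    have {}H := le_trans H (lerD (ltW hn) (lexx _)).
    by rewrite -lerBlDl in H; rewrite [X in X - _](splitr `|h0|) addrK in H.
  have cn0 : 0 <= c n by apply: le_trans (le n n0); rewrite mulr_ge0.
  have cn' : c n <= `|c0| + 1.
    rewrite -(ger0_norm cn0); have := ler_normB c0 (c0 - c n).
    rewrite subKr => H; apply: le_trans H _.
    by rewrite lerD2l ltW.
  have : (`|c0| + 1) < n%:R * (`|h0| / 2).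
    by rewrite -ltr_pdivrMr //; apply: lt_le_trans HN _; rewrite ler_nat.
  move=> /lt_le_trans - /(_ (n%:R * h n)); rewrite ler_wpM2l // => /(_ isT).
  move=> /lt_le_trans - /(_ _ (le _ n0)) /lt_le_trans - /(_ _ cn').
  by rewrite ltxx.
by move=> /filter_ex [].
Unshelve. all: by end_near.
Qed.

Lemma continuous_root_sum (K : numFieldType) (a b : K) :
  continuous (root_sum a b).
Proof.
move=> l; have FF : Filter (nbhs l) by exact: nbhs_filter.
have sqr : x ^+ 2 @[x --> l] --> l ^+ 2 by apply: (cvgM cvg_id cvg_id).
exact: (cvgB (cvgD sqr (cvg_cst (a ^+ 2))) (cvg_cst (b ^+ 2))).
Qed.

Lemma continuous_modulus_gap (K : numFieldType) (a b : K) :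
  continuous (modulus_gap a b).
Proof.
move=> l; have FF : Filter (nbhs l) by exact: nbhs_filter.
have sqr (f : K -> K) (y : K) :
    f x @[x --> l] --> y -> f x ^+ 2 @[x --> l] --> y ^+ 2.
  by move=> fy; apply: (cvgM fy fy).
have t := @continuous_root_sum K a b l.
have al : a * x @[x --> l] --> a * l by apply: (cvgM (cvg_cst a) cvg_id).
have four (f : K -> K) (y : K) :
    f x @[x --> l] --> y -> 4 * f x @[x --> l] --> 4 * y.
  by move=> fy; apply: (cvgM (cvg_cst (4 : K)) fy).
exact: (cvgB (cvgD (sqr _ _ (cvg_norm t))
  (cvg_norm (cvgB (sqr _ _ t) (four _ _ (sqr _ _ al)))))
  (four _ _ (sqr _ _ (cvg_norm al)))).
Qed.

Lemma continuous_modulus_gapM (K : numFieldType) (a b c : K) :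
  continuous (fun x => modulus_gap a b x * c).
Proof.
move=> l; have FF : Filter (nbhs l) by exact: nbhs_filter.
by apply: (cvgM (@continuous_modulus_gap K a b l) (cvg_cst c)).
Qed.

Lemma continuous_modulus_gap_bound (K : numFieldType) (a b : K) :
  continuous (modulus_gap_bound a b).
Proof.
move=> l; have FF : Filter (nbhs l) by exact: nbhs_filter.
have t := @continuous_root_sum K a b l.
have al : a * x @[x --> l] --> a * l by apply: (cvgM (cvg_cst a) cvg_id).
have M : `|root_sum a b x| + `|a * x| @[x --> l] -->
    `|root_sum a b l| + `|a * l| by exact: (cvgD (cvg_norm t) (cvg_norm al)).
have Ma : `|root_sum a b x| + `|a * x| + `|a ^+ 2| @[x --> l] -->
    `|root_sum a b l| + `|a * l| + `|a ^+ 2|.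
  by exact: (cvgD M (cvg_cst `|a ^+ 2|)).
exact: (cvgM (cvgM (cvg_cst (2 : K)) M) (cvgM (cvgM Ma Ma) M)).
Qed.

Lemma limit_eq0_of_natM_bounded (K : numFieldType) (f g : K -> K)
    (z : nat -> K) (l : K) :
    (forall x : K, 0 <= x -> exists n, x < n%:R) ->
    continuous f -> continuous g -> z n @[n --> \oo] --> l ->
    (forall x, 0 <= f x) ->
    (forall n, (0 < n)%N -> n%:R * f (z n) <= g (z n)) ->
  f l = 0.
Proof.
move=> archi cf cg zl f0 le.
apply: (@cvg_eq0_of_natM_bounded K (f \o z) (g \o z) _ (g l) archi) => //.
- exact: (cvg_comp _ _ zl (cf l)).
- exact: (cvg_comp _ _ zl (cg l)).
- by move=> n; exact: f0.
Qed.

Lemma limiting_spectrum_modulus_gap0 (R : realType) (a b l : R[i]) :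
    a != 0 -> b != 0 -> limiting_spectrum (T_mx a b) l ->
  modulus_gap a b l = 0.
Proof.
move=> a0 b0 [z [phi [ev mono zl]]].
have phi_ge n : (n <= phi n)%N.
  by elim: n => // n IH; apply: leq_ltn_trans IH (mono _ _ _).
have gap_ge0 x : 0 <= modulus_gap a b x.
  have [p [q [pDq pMq]]] := ex_sum_prod (root_sum a b x) ((a * x) ^+ 2).
  rewrite (modulus_gapE pDq pMq) mulr_ge0 //.
  by apply: real_exprn_even_ge0 => //; apply: rpredB; apply: normr_real.
have ab0 : 0 < `|a * b| ^+ 2 by rewrite exprn_gt0 // normr_gt0 mulf_neq0.
suff /eqP : modulus_gap a b l * `|a * b| ^+ 2 = 0.
  by rewrite mulf_eq0 (gt_eqF ab0) orbF => /eqP.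
apply: (limit_eq0_of_natM_bounded (@complex_archi R)
  (@continuous_modulus_gapM _ a b (`|a * b| ^+ 2))
  (@continuous_modulus_gap_bound _ a b) zl).
- by move=> x; rewrite mulr_ge0 // ltW.
- move=> n n0; have pn0 := leq_trans n0 (phi_ge n).
  apply: le_trans (eigenvalue_modulus_gap_le a0 b0 pn0 (ev _ pn0)).
  by rewrite ler_wpM2r ?mulr_ge0 ?ler_nat // ltW.
Qed.

(** * The curve *)

(** Completing the square, l - a cos(theta) is a square root of
b^2 - a^2 sin(theta)^2. *)
Lemma spectral_curveP (R : realType) (a b l : R[i]) (theta : R) :
    theta \in `[- pi, pi] ->
    root_sum a b l = 2 * (a * l) * (cos theta)%:C ->
  spectral_curve a b l.
Proof.
move=> th E; exists theta => //=.
set r := sqrtC _; set c := (cos theta)%:C in E *.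
have sc : (sin theta)%:C ^+ 2 = 1 - c ^+ 2.
  by rewrite -!rmorphXn /= sin2cos2 rmorphB rmorph1.
have /eqP : (l - a * c) ^+ 2 = r ^+ 2.
  rewrite sqrtCK sc; apply: (eq_sub_transfer E); rewrite /root_sum; ring.
by rewrite eqf_sqr => /orP[] /eqP H; [left|right]; rewrite -H; ring.
Qed.

(** For a l <> 0 the angle is the argument of the unimodular number p / (a l),
up to sign: only its cosine matters.  For a l = 0 both roots vanish and any
angle will do. *)
Lemma modulus_gap0_spectral_curve (R : realType) (a b l : R[i]) :
  modulus_gap a b l = 0 -> spectral_curve a b l.
Proof.
have [p [q [pDq pMq]]] := ex_sum_prod (root_sum a b l) ((a * l) ^+ 2).
rewrite (modulus_gapE pDq pMq) => /eqP.
rewrite mulf_eq0 pnatr_eq0 /= expf_eq0 /= subr_eq0 => /eqP pq.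
have nal : `|a * l| = `|p|.
  apply/eqP; rewrite -(eqrXn2 (n := 2)) //.
  by rewrite -normrX -pMq normrM -pq -expr2.
have [al0|al0] := eqVneq (a * l) 0.
  apply: (@spectral_curveP _ _ _ _ 0).
    by rewrite in_itv /= oppr_le0 pi_ge0.
  move: nal; rewrite al0 normr0 mulr0 mul0r -pDq => /esym/eqP.
  move=> np; move: np (np); rewrite {1}pq !normr_eq0 => /eqP -> /eqP ->.
  by rewrite addr0.
pose w := p / (a * l).
have pE : p = a * l * w by rewrite /w mulrC divfK.
have nw : `|w| = 1 by rewrite normf_div -nal divff // normr_eq0.
have w0 : w != 0 by rewrite -normr_gt0 nw.
have qE : q = a * l * w^*.
  apply: (mulfI (mulf_neq0 al0 w0)).
  rewrite -pE pMq pE mulrACA -normCK nw; ring.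
have rew : `|complex.Re w| <= 1.
  rewrite -lecR; have <- : `|w| = 1%:C by rewrite nw.
  exact: normc_ge_Re.
have rw : -1 <= complex.Re w <= 1 by rewrite -ler_norml.
apply: (@spectral_curveP _ _ _ _ (acos (complex.Re w))).
  rewrite in_itv /= acos_lepi // andbT (le_trans _ (acos_ge0 rw)) //.
  by rewrite oppr_le0 pi_ge0.
rewrite acosK ?in_itv //= -pDq pE qE.
have E : w + w^* = 2 * (complex.Re w)%:C := addcJ w.
by rewrite -mulrDr E; ring.
Qed.

Theorem theorem2p2 (R : realType) (a b : R[i]) (ha : a != 0) (hb : b != 0)
    (l : R[i]) (hl : limiting_spectrum (T_mx a b) l) :
  spectral_curve a b l \/
  ((l = sqrtC (2^-1 * b ^+ 2 - a ^+ 2) \/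
    l = - sqrtC (2^-1 * b ^+ 2 - a ^+ 2)) /\
   `|a ^+ 2| > `|2^-1 * b ^+ 2 - a ^+ 2|).
Proof.
by left; apply/modulus_gap0_spectral_curve/limiting_spectrum_modulus_gap0.
Qed.
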